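(* Let $m = 2k \ge 2$ and $n \ge 2$, and let $\mathcal{A}$ be an $m$th order $n$ dimensional generalized anti-circulant tensor with circulant index $r = 2$ and generating vector $\mathbf{v} = (v_0, \dots, v_{(n-1)m})^\top$. Then $\mathcal{A}$ is PSD if and only if $|v_1| \le v_0$. In this case, one may write $v_1 = v_0(2t-1)$ with $t \in [0,1]$, and then the Hankel polynomial $f$ of $\mathcal{A}$ satisfies, for all $\mathbf{x} \in \mathbb{R}^n$, $$f(\mathbf{x}) = t v_0 (x_1 + \cdots + x_n)^m + (1-t) v_0 \left(x_1 - x_2 + x_3 - \cdots + (-1)^{n-1} x_n\right)^m,$$ and $\mathcal{A}$ is a strong Hankel tensor.
   Context: Let $m, n \ge 2$ and $\mathbf{v} = (v_0, \dots, v_{(n-1)m})^\top \in \mathbb{R}^{(n-1)m+1}$. The $m$th order $n$ dimensional Hankel tensor with generating vector $\mathbf{v}$ is $\mathcal{A} = (a_{i_1 \cdots i_m})$ with $a_{i_1\cdots i_m} = v_{i_1 + \cdots + i_m - m}$ for $i_1, \dots, i_m = 1, \dots, n$. Given $1 \le r \le n$, $\mathcal{A}$ is called a generalized anti-circulant tensor with circulant index $r$ if $v_i = v_{i+r}$ for all $i = 0, \dots, (n-1)m - r$. The Hankel polynomial of $\mathcal{A}$ is $f(\mathbf{x}) = \sum_{i_1, \dots, i_m = 1}^n v_{i_1 + \cdots + i_m - m}\, x_{i_1} \cdots x_{i_m}$ for $\mathbf{x} = (x_1, \dots, x_n)^\top \in \mathbb{R}^n$. Let $m = 2k$ be even. $\mathcal{A}$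 is PSD (positive semi-definite) if $f(\mathbf{x}) \ge 0$ for all $\mathbf{x} \in \mathbb{R}^n$. The associated Hankel matrix is the $(nk-k+1)\times(nk-k+1)$ matrix $A = (a_{ij})$ with $a_{ij} = v_{i+j-2}$ for $i, j = 1, \dots, nk-k+1$. $\mathcal{A}$ is a strong Hankel tensor if $A$ is positive semi-definite. *)

(* Defs.v *)
From HB Require Import structures.
From mathcomp Require Import all_boot all_order all_algebra.
From mathcomp Require Import reals.
Set Implicit Arguments.
Unset Strict Implicit.
Unset Printing Implicit Defensive.
Import Order.TTheory GRing.Theory Num.Theory.
Local Open Scope ring_scope.

(* Tensor modes are indexed from 0: the 1-based index i_j is represented by   *)
(* i_j - 1 in 'I_n, so the offset - m in v_(i_1 + ... + i_m - m) disappears.  *)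
Definition tensor (R : realType) (m n : nat) := {ffun m.-tuple 'I_n -> R}.

Definition tensor_form (R : realType) (m n : nat) (A : tensor R m n)
    (x : 'cV[R]_n) : R :=
  \sum_(i : m.-tuple 'I_n) A i * \prod_(j < m) x (tnth i j) 0.

Definition tensor_psd (R : realType) (m n : nat) (A : tensor R m n) : Prop :=
  forall x : 'cV[R]_n, 0 <= tensor_form A x.

Definition mx_psd (R : realType) (n : nat) (A : 'M[R]_n) : Prop :=
  A^T = A /\ forall x : 'cV[R]_n, 0 <= (x^T *m A *m x) 0 0.

(* [inord] gives the entry v_i for i <= N; every use below is in that range.  *)
Definition ventry (R : realType) (N : nat) (v : 'cV[R]_N.+1) (i : nat) : R :=
  v (inord i) 0.

Definition hankel_tensor (R : realType) (m n : nat)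
    (v : 'cV[R]_((n - 1) * m).+1) : tensor R m n :=
  [ffun i : m.-tuple 'I_n => ventry v (\sum_(j < m) tnth i j)%N].

Definition hankel_poly (R : realType) (m n : nat)
    (v : 'cV[R]_((n - 1) * m).+1) (x : 'cV[R]_n) : R :=
  tensor_form (hankel_tensor v) x.

Definition generalized_anti_circulant (R : realType) (m n : nat)
    (v : 'cV[R]_((n - 1) * m).+1) (r : nat) : Prop :=
  (1 <= r <= n)%N /\
  forall i : nat, (i + r <= (n - 1) * m)%N -> ventry v i = ventry v (i + r).

Definition associated_hankel_mx (R : realType) (k n : nat)
    (v : 'cV[R]_((n - 1) * (2 * k)).+1) : 'M[R]_((n * k - k).+1) :=
  \matrix_(i, j) ventry v (i + j).

Definition strong_hankel (R : realType) (k n : nat)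
    (v : 'cV[R]_((n - 1) * (2 * k)).+1) : Prop :=
  mx_psd (associated_hankel_mx v).

(* Main.v *)
Require Import Defs.
From HB Require Import structures.
From mathcomp Require Import all_boot all_order all_algebra.
From mathcomp Require Import reals.
From mathcomp Require Import zify ring lra.
Set Implicit Arguments.
Unset Strict Implicit.
Unset Printing Implicit Defensive.
Import Order.TTheory GRing.Theory Num.Theory.
Local Open Scope ring_scope.

(** A sequence of period 2 is a combination of the two characters of Z/2:
    [v_i = a + b (-1)^i] with [a = (v_0 + v_1) / 2] and [b = (v_0 - v_1) / 2]
    ([ventry_circulant2]).  Each character [i |-> c^i] turns sums of indices
    into products, so it contributes a rank-one piece: to the tensor, an
    [m]-th power of a linear form ([sum_tuple_prod]), and to the associated
    Hankel matrix, the square of a linear form.  Therefore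
    [f x = a (\sum_i x_i)^m + b (\sum_i (-1)^i x_i)^m]
    ([hankel_poly_circulant2]), and the quadratic form of the associated matrix
    is the same expression with exponent 2 ([associated_hankel_quad]).

    As [m] is even, both forms are nonnegative once [a] and [b] are, and
    [0 <= a], [0 <= b] together say [`|v_1| <= v_0].  Conversely [a] and [b]
    are read off, up to a positive factor, by evaluating [f] at
    [e_0 + e_1] and [e_0 - e_1], where one of the two linear forms vanishes.
    Finally [v_1 = v_0 (2 t - 1)] just means [a = t v_0] and
    [b = (1 - t) v_0]. *)

(** Expanding a power by choosing one summand in each of the [m] factors; this
    is [bigA_distr_bigA] with choice functions replaced by tuples. *)
Lemma sum_tuple_prod (R : comNzRingType) (m n : nat) (F : 'I_n -> R) :
  \sum_(i : m.-tuple 'I_n) \prod_(j < m) F (tnth i j) = (\sum_i F i) ^+ m.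
Proof.
rewrite -[in RHS](card_ord m) -prodr_const bigA_distr_bigA /=.
rewrite (reindex (fun f : {ffun 'I_m -> 'I_n} => [tuple f j | j < m])) /=.
  by apply: eq_bigr => f _; apply: eq_bigr => j _; rewrite tnth_mktuple.
apply: onW_bij; exists (fun t : m.-tuple 'I_n => [ffun j => tnth t j]) => [f|t].
  by apply/ffunP => j; rewrite ffunE tnth_mktuple.
by apply: eq_from_tnth => j; rewrite tnth_mktuple ffunE.
Qed.

(** A character [i |-> c^i] sends the sum of the indices to a product, so the
    tensor it generates is the [m]-th tensor power of [(1, c, c^2, ...)]. *)
Lemma sum_tuple_character (R : comNzRingType) (m n : nat) (c : R)
    (x : 'cV[R]_n) :
  \sum_(i : m.-tuple 'I_n)
     c ^+ (\sum_(j < m) tnth i j)%N * \prod_(j < m) x (tnth i j) 0 =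
  (\sum_(i < n) c ^+ i * x i 0) ^+ m.
Proof.
rewrite -sum_tuple_prod; apply: eq_bigr => i _.
by rewrite (big_morph _ (exprD c) (expr0 c)) -big_split.
Qed.

Section CirculantIndex2.

Variables (R : realType) (m n : nat) (v : 'cV[R]_((n - 1) * m).+1).
Hypothesis hv : generalized_anti_circulant v 2.

Let a := (ventry v 0 + ventry v 1) / 2.
Let b := (ventry v 0 - ventry v 1) / 2.

(** The induction carries two consecutive entries, since periodicity relates
    [v_(i+2)] to [v_i]. *)
Lemma ventry_circulant2 (i : nat) :
  (i <= (n - 1) * m)%N -> ventry v i = a + b * (-1) ^+ i.
Proof.
case: hv => _ per.
suff [] : ((i <= (n - 1) * m)%N -> ventry v i = a + b * (-1) ^+ i) /\
          ((i.+1 <= (n - 1) * m)%N -> ventry v i.+1 = a + b * (-1) ^+ i.+1).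
  by [].
elim: i => [|i [IHi IHi1]].
  by split=> _; rewrite ?expr0 ?expr1 /a /b; field.
split=> // le_i2; rewrite -addn2 -per ?addn2 // IHi; last lia.
by rewrite !exprS; ring.
Qed.

Lemma hankel_poly_circulant2 (x : 'cV[R]_n) :
  hankel_poly v x =
  a * (\sum_(i < n) x i 0) ^+ m + b * (\sum_(i < n) (-1) ^+ i * x i 0) ^+ m.
Proof.
have -> : \sum_(i < n) x i 0 = \sum_(i < n) 1 ^+ i * x i 0.
  by apply: eq_bigr => i _; rewrite expr1n mul1r.
rewrite -!sum_tuple_character !mulr_sumr -big_split; apply: eq_bigr => i _.
rewrite ffunE ventry_circulant2; first by rewrite /= expr1n; ring.
(* Each of the [m] indices is at most [n - 1], so their sum is in range. *)
rewrite -[leqRHS]/((n - 1) * m)%N mulnC -[X in (_ <= X * _)%N]card_ord.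
rewrite -sum_nat_const leq_sum // => j _.
by case: (tnth i j) => l lt_ln; rewrite subn1 -ltnS (ltn_predK lt_ln).
Qed.

Lemma coef_ge0 : `|ventry v 1| <= ventry v 0 -> 0 <= a /\ 0 <= b.
Proof. by rewrite ler_norml /a /b => /andP[]; split; lra. Qed.

End CirculantIndex2.

Lemma associated_hankel_quad (R : realType) (k n : nat)
    (v : 'cV[R]_((n - 1) * (2 * k)).+1) (x : 'cV[R]_(n * k - k).+1) :
  generalized_anti_circulant v 2 ->
  (x^T *m associated_hankel_mx v *m x) 0 0 =
  (ventry v 0 + ventry v 1) / 2 * (\sum_(i < (n * k - k).+1) x i 0) ^+ 2 +
  (ventry v 0 - ventry v 1) / 2 *
    (\sum_(i < (n * k - k).+1) (-1) ^+ i * x i 0) ^+ 2.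
Proof.
move=> hv; rewrite mxE !expr2 !mulr_sumr -big_split; apply: eq_bigr => j _.
rewrite mxE /=.
rewrite !mulr_suml !mulr_sumr -big_split; apply: eq_bigr => i _.
rewrite !mxE (ventry_circulant2 hv) ?exprD; first by rewrite /=; ring.
by have := ltn_ord i; have := ltn_ord j; nia.
Qed.

Lemma strong_hankel_circulant2 (R : realType) (k n : nat)
    (v : 'cV[R]_((n - 1) * (2 * k)).+1) :
  generalized_anti_circulant v 2 -> `|ventry v 1| <= ventry v 0 ->
  strong_hankel v.
Proof.
move=> hv /coef_ge0 [a0 b0]; split.
  by apply/matrixP => i j; rewrite !mxE addnC.
move=> x; rewrite associated_hankel_quad //.
by apply: addr_ge0; apply: mulr_ge0 => //; exact: sqr_ge0.
Qed.

(** Test vector [e_0 + s e_1]: for [s = 1] the alternating form vanishes on it,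
    for [s = -1] the plain sum does. *)
Definition two_point (R : realType) (n : nat) (s : R) : 'cV[R]_n :=
  \col_i (if i == 0 :> nat then 1 else if i == 1 :> nat then s else 0).

Lemma sum_two_point (R : realType) (n : nat) (s : R) (F : nat -> R) :
  (2 <= n)%N -> \sum_(i < n) F i * two_point n s i 0 = F 0 + F 1%N * s.
Proof.
case: n => [|[|n]] // _; rewrite !big_ord_recl big1 ?addr0.
  by rewrite !mxE /= mulr1.
by move=> i _; rewrite mxE /= mulr0.
Qed.

Lemma psd_circulant2 (R : realType) (k n : nat)
    (v : 'cV[R]_((n - 1) * (2 * k)).+1) :
  (0 < k)%N -> (2 <= n)%N -> generalized_anti_circulant v 2 ->
  tensor_psd (hankel_tensor v) <-> `|ventry v 1| <= ventry v 0.
Proof.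
move=> k_gt0 hn hv; split=> [psd|/coef_ge0 [a0 b0] x]; last first.
  rewrite -[tensor_form _ _]/(hankel_poly v x) hankel_poly_circulant2 //.
  rewrite !exprM; apply: addr_ge0; apply: mulr_ge0 => //;
    by rewrite exprn_ge0 ?sqr_ge0.
have sumE s : \sum_(i < n) two_point n s i 0 = 1 + s.
  rewrite -[s in RHS]mul1r -(sum_two_point s (fun=> 1) hn).
  by apply: eq_bigr => i _; rewrite mul1r.
have pow_gt0 : 0 < (2 : R) ^+ (2 * k) by rewrite exprn_gt0.
have eval s : 0 <= (ventry v 0 + ventry v 1) / 2 * (1 + s) ^+ (2 * k) +
                   (ventry v 0 - ventry v 1) / 2 * (1 - s) ^+ (2 * k).
  have := psd (two_point n s).
  rewrite -[tensor_form _ _]/(hankel_poly v _) hankel_poly_circulant2 // sumE.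
  by rewrite (sum_two_point s (fun i => (-1) ^+ i)) // expr0 expr1 mulN1r.
have zpow : (0 : R) ^+ (2 * k) = 0.
  by rewrite expr0n gtn_eqF ?muln_gt0.
have := eval 1; have := eval (-1).
rewrite subrr opprK zpow !mulr0 addr0 add0r -[1 + 1]/2.
rewrite !(pmulr_lge0 _ pow_gt0) => b0 a0.
by rewrite ler_norml; apply/andP; split; lra.
Qed.

Lemma mixing_parameter (R : realType) (p q : R) :
  `|q| <= p -> exists2 t : R, 0 <= t <= 1 & q = p * (2 * t - 1).
Proof.
move=> le_qp; have := le_qp; rewrite ler_norml => /andP[le1 le2].
have [p0|p_neq0] := eqVneq p 0.
  by exists 0; [rewrite lexx ler01 | lra].
have p_gt0 : 0 < p by rewrite lt_neqAle eq_sym p_neq0 (le_trans _ le_qp).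
(* With [p = v_0] and [q = v_1] this is [a / v_0]. *)
exists ((p + q) / (2 * p)); last by field.
by rewrite divr_ge0 ?ler_pdivrMr ?mulr_gt0 //=; lra.
Qed.

Theorem theorem4 (R : realType) (k n : nat) (v : 'cV[R]_((n - 1) * (2 * k)).+1)
    (hm : (2 <= 2 * k)%N) (hn : (2 <= n)%N)
    (hv : generalized_anti_circulant v 2) :
  (tensor_psd (hankel_tensor v) <-> `|ventry v 1| <= ventry v 0) /\
  (tensor_psd (hankel_tensor v) ->
    [/\ exists2 t : R, 0 <= t <= 1 & ventry v 1 = ventry v 0 * (2 * t - 1),
        forall t : R, 0 <= t <= 1 -> ventry v 1 = ventry v 0 * (2 * t - 1) ->
          forall x : 'cV[R]_n,
            hankel_poly v x =
              t * ventry v 0 * (\sum_(i < n) x i 0) ^+ (2 * k) +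
              (1 - t) * ventry v 0 *
                (\sum_(i < n) (-1) ^+ i * x i 0) ^+ (2 * k)
      & strong_hankel v]).
Proof.
have k_gt0 : (0 < k)%N by lia.
have psdE := psd_circulant2 k_gt0 hn hv.
split=> // /psdE le_v; split.
- exact: mixing_parameter.
- move=> t _ v1E x; rewrite hankel_poly_circulant2 // v1E.
  by congr (_ * _ + _ * _); field.
- exact: strong_hankel_circulant2.
Qed.
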